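(* Let $d\ge 2$, let $X$ and $Y$ be $\mathbb{R}^d$ equipped with (possibly different) quasi-norms, and assume that $X$ is monotone. Let $k\ge d+\lceil\log_2 d\rceil+1$ be a natural number. Then $$ e_k(\mathbb{S}_X,Y)\;\le\; 2\,\|\mathrm{Id}:\ell_\infty^d\to Y\|\,\max_{1\le i\le d} e_{k-d-\lceil\log_2 d\rceil}(B_{X_i},\ell_\infty^{d-1}). $$
   Context: $B_X$ and $\mathbb{S}_X$ denote the closed unit ball and the unit sphere $\{x:\|x\|_X=1\}$ of $X$. $X$ is called monotone if for any sign vector $e\in\{-1,1\}^d$ and any $x,y$ in the orthant associated with $e$ (the vectors with $e_jx_j\ge0$ and $e_jy_j\ge0$ for all $j$) with $|x_j|\le|y_j|$ for every $j=1,\dots,d$ one has $\|x\|_X\le\|y\|_X$. For $1\le i\le d$, $H_i\subset\mathbb{R}^d$ is the hyperplane of vectors whose $i$-th coordinate equals $0$; $X_i$ is $H_i$ considered as a subspace of $X$, i.e. its unit ball is $B_{X_i}=B_X\cap H_i$. $H_i$ is identified with $\mathbb{R}^{d-1}$ by deleting the $i$-th coordinate. $\ell_\infty^n$ is $\mathbb{R}^n$ with the norm $\|x\|_\infty=\max_j|x_j|$, and $\|\mathrm{Id}:\ell_\infty^d\to Y\|=\sup\{\|x\|_Y:\|x\|_\infty\le1\}$. For a subset $K$ of a finite-dimensional (quasi-)Banach space $Z$ with closed unit ball $B_Z$, and $k\in\mathbb{N}$, $k\ge1$, the $k$-th (dyadic) entropy number is $$e_k(K,Z)=\min\Big\{\varepsilon>0: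 K\subset\bigcup_{j=1}^{2^{k-1}}(x_j+\varepsilon B_Z)\text{ for some }x_1,\dots,x_{2^{k-1}}\in Z\Big\}.$$ *)

(* Defs.v *)
From HB Require Import structures.
From mathcomp Require Import all_boot all_order all_algebra.
From mathcomp Require Import all_classical all_reals all_analysis.

Set Implicit Arguments.
Unset Strict Implicit.
Unset Printing Implicit Defensive.

Import Order.TTheory GRing.Theory Num.Theory.
Import numFieldNormedType.Exports.

Local Open Scope classical_set_scope.
Local Open Scope ring_scope.

(* R^n is 'rV[R]_n; a space "R^n with a quasi-norm" is represented by its
   quasi-norm q : 'rV[R]_n -> R. *)

Record quasinorm (R : realType) (n : nat) (q : 'rV[R]_n -> R) : Prop :=
  Quasinorm {
    quasinorm_ge0 : forall x, 0 <= q x;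
    quasinorm_eq0 : forall x, q x = 0 -> x = 0;
    quasinormZ : forall a x, q (a *: x) = `|a| * q x;
    quasinormD : exists2 C : R, 1 <= C & forall x y, q (x + y) <= C * (q x + q y)
  }.

Definition unit_ball (R : realType) (n : nat) (q : 'rV[R]_n -> R) :
  set 'rV[R]_n := [set x | q x <= 1].

Definition unit_sphere (R : realType) (n : nat) (q : 'rV[R]_n -> R) :
  set 'rV[R]_n := [set x | q x = 1].

Definition sign_vector (R : realType) (n : nat) (e : 'rV[R]_n) : Prop :=
  forall j, e 0 j = -1 \/ e 0 j = 1.

Definition orthant (R : realType) (n : nat) (e : 'rV[R]_n) : set 'rV[R]_n :=
  [set x | forall j, 0 <= e 0 j * x 0 j].

Definition monotone_qnorm (R : realType) (n : nat) (q : 'rV[R]_n -> R) : Prop :=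
  forall e x y : 'rV[R]_n, sign_vector e -> orthant e x -> orthant e y ->
    (forall j, `|x 0 j| <= `|y 0 j|) -> q x <= q y.

Definition hyperplane (R : realType) (n : nat) (i : 'I_n) : set 'rV[R]_n :=
  [set x | x 0 i = 0].

(* The unit ball of X_i, carried to R^(n-1) by deleting the i-th coordinate. *)
Definition section_ball (R : realType) (n : nat) (q : 'rV[R]_n -> R)
    (i : 'I_n) : set 'rV[R]_n.-1 :=
  [set col' i x | x in unit_ball q `&` hyperplane i].

(* The library norm of a matrix is the maximum of the absolute values of its
   entries (mx_normrE). *)
Definition linfty (R : realType) (n : nat) (x : 'rV[R]_n) : R := `|x|.

Definition Id_norm (R : realType) (n : nat) (q : 'rV[R]_n -> R) : \bar R :=
  ereal_sup [set (q x)%:E | x in unit_ball (@linfty R n)].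

Definition covered_by (R : realType) (n : nat) (q : 'rV[R]_n -> R)
    (K : set 'rV[R]_n) (N : nat) (eps : R) : Prop :=
  exists c : 'I_N -> 'rV[R]_n,
    K `<=` \bigcup_(j in [set: 'I_N]) [set c j + eps *: z | z in unit_ball q].

(* The infimum is taken in the extended reals, so that it is +oo when no
   radius is admissible; it is the minimum whenever that is attained.
   Meaningful for 1 <= k only, since k.-1 is truncated at k = 0. *)
Definition entropy_number (R : realType) (n : nat) (q : 'rV[R]_n -> R)
    (K : set 'rV[R]_n) (k : nat) : \bar R :=
  ereal_inf [set eps%:E | eps in [set eps : R |
    0 < eps /\ covered_by q K (2 ^ k.-1) eps]].

(* Main.v *)
Require Import Defs.
From HB Require Import structures.
From mathcomp Require Import all_boot all_order all_algebra.
From mathcomp Require Import all_classical all_reals all_analysis.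
From mathcomp Require Import lra zify.

Set Implicit Arguments.
Unset Strict Implicit.
Unset Printing Implicit Defensive.

(** In one orthant, with sign vector e, the sphere of a monotone quasi-norm q
    behaves like a graph over the directions transversal to e: moving from y by
    an amount that increases every |y_j| leaves the sphere
    ([unit_sphere_no_gap]), since such an x dominates a *: y for some a > 1.
    Hence two points of the sphere lying in the same tube
    c + R e + [-eps, eps]^n have parameters t along e that differ by at most
    2 eps, so the part of the sphere in the tube has t in an interval of length
    2 eps; centring a cube at the middle of this interval costs eps for t and
    eps for the tube, so a single cube of radius 2 eps suffices
    ([tube_in_cube]).

    Every point x of the sphere lies in one of few such tubes: with
    t = min_j |x_j| attained at i, the point x - t *: e has i-th coordinate 0
    and is dominated by x, so it belongs to the ball of the i-th section, which
    is covered by N cubes of radius eps ([sphere_to_section]).  Counting sign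
    vectors, indices i and cubes gives 2^n * n * N cubes of radius 2 eps
    covering the sphere ([covered_unit_sphere]).  Taking N = 2^(m-1) with
    m = k - d - up_log 2 d makes this at most 2^(k-1), as d <= 2^(up_log 2 d).  A cube of radius 2 eps
    is contained in a ball of Y of radius 2 ||Id|| eps, where ||Id|| is finite
    and positive ([Id_norm_fin]), and the theorem follows by letting eps
    decrease to the largest entropy number of the sections. *)

Import Order.TTheory GRing.Theory Num.Theory.
Import numFieldNormedType.Exports.

Local Open Scope classical_set_scope.
Local Open Scope ring_scope.

(** * Quasi-norms on row vectors *)

Lemma normr_row_leP (R : realType) (n : nat) (x : 'rV[R]_n) (r : R) :
  0 <= r -> (forall j, `|x 0 j| <= r) <-> `|x| <= r.
Proof.
move=> r0; have -> : `|x| = \big[Num.max/0]_ij `|x ij.1 ij.2| := mx_normrE x.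
split=> [xr|/bigmax_leP[_ xr] j]; last exact: (xr (0, j)).
by apply/bigmax_leP; split=> // -[i j] _; rewrite ord1.
Qed.

Lemma linfty_quasinorm (R : realType) (n : nat) : quasinorm (@linfty R n).
Proof.
split; rewrite /linfty.
- by move=> x.
- by move=> x /normr0_eq0.
- by move=> a x; rewrite normrZ.
- by exists 1 => // x y; rewrite mul1r ler_normD.
Qed.

Lemma quasinorm0 (R : realType) (n : nat) (q : 'rV[R]_n -> R) :
  quasinorm q -> q 0 = 0.
Proof. by move=> hq; rewrite -[0 in LHS](scale0r 0) quasinormZ// normr0 mul0r. Qed.

(** Expanding x in the standard basis and using the quasi-triangle inequality
    once per basis vector; the bound grows by a factor C at each step, which is
    harmless as the dimension is fixed. *)
Lemma quasinorm_bounded (R : realType) (n : nat) (q : 'rV[R]_n -> R) :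
  quasinorm q -> exists B, forall x, `|x| <= 1 -> q x <= B.
Proof.
move=> hq; have [C C1 qD] := quasinormD hq.
suff [B qB] : exists B, forall x : 'rV[R]_n, `|x| <= 1 ->
    q (\sum_(j <- index_enum 'I_n) x 0 j *: delta_mx 0 j) <= B.
  by exists B => x /qB; rewrite -row_sum_delta.
elim: (index_enum 'I_n) => [|i s [B qB]].
  by exists 0 => x _; rewrite big_nil quasinorm0.
exists (C * (q (delta_mx 0 i) + B)) => x x1; rewrite big_cons.
apply: (le_trans (qD _ _)); apply: ler_wpM2l; first lra.
apply: lerD (qB x x1); rewrite quasinormZ//.
apply: ler_piMl; first exact: quasinorm_ge0.
exact: (normr_row_leP x ler01).2.
Qed.

(** Both finiteness and positivity matter: they exclude the products 0 * oo in
    the extended reals, so that the bound on the entropy number passes to the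
    limit whether the entropy numbers of the sections are finite or not. *)
Lemma Id_norm_fin (R : realType) (n : nat) (q : 'rV[R]_n -> R) :
  (0 < n)%N -> quasinorm q ->
  exists l : R, [/\ 0 < l, Id_norm q = l%:E & forall x, q x <= l * `|x|].
Proof.
move=> n0 hq; have [B qB] := quasinorm_bounded hq.
have Id_ub x : `|x| <= 1 -> ((q x)%:E <= Id_norm q)%E.
  by move=> x1; apply: ereal_sup_ubound; exists x.
have Id_le : (Id_norm q <= B%:E)%E.
  by apply: ge_ereal_sup => _ [x x1 <-]; rewrite lee_fin; exact: qB.
pose u : 'rV[R]_n := const_mx 1.
have u1 : `|u| <= 1 by apply/(normr_row_leP _ ler01) => j; rewrite mxE normr1.
have qu : 0 < q u.
  rewrite lt_neqAle (quasinorm_ge0 hq) andbT; apply/eqP => /esym/(quasinorm_eq0 hq).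
  by move/rowP/(_ (Ordinal n0)); rewrite !mxE; apply/eqP/oner_neq0.
have Id_gt0 : (0 < Id_norm q)%E by apply: lt_le_trans (Id_ub u u1); rewrite lte_fin.
have Id_num : Id_norm q \is a fin_num.
  by rewrite fin_real// (lt_trans _ Id_gt0)//= (le_lt_trans Id_le)// ltry.
exists (fine (Id_norm q)); split=> [||x]; rewrite ?fineK//.
  by rewrite fine_gt0// Id_gt0 ltey_eq Id_num.
have [->|x0] := eqVneq x 0; first by rewrite quasinorm0// normr0 mulr0.
have nx : 0 < `|x| by rewrite normr_gt0.
rewrite -ler_pdivrMr// -lee_fin fineK// mulrC.
have -> : `|x|^-1 * q x = q (`|x|^-1 *: x).
  by rewrite quasinormZ// gtr0_norm// invr_gt0.
by apply: Id_ub; rewrite normrZ gtr0_norm ?invr_gt0// mulVf// gt_eqF.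
Qed.

(** * Coverings and entropy numbers *)

Lemma scaled_unit_ballP (R : realType) (n : nat) (q : 'rV[R]_n -> R)
    (c x : 'rV[R]_n) (eps : R) : quasinorm q -> 0 < eps ->
  [set c + eps *: z | z in unit_ball q] x <-> q (x - c) <= eps.
Proof.
move=> hq e0; split=> [[z qz <-]|qx].
  by rewrite addrC addKr quasinormZ// gtr0_norm// ger_pMr.
exists (eps^-1 *: (x - c)).
  by rewrite /unit_ball/= quasinormZ// gtr0_norm ?invr_gt0// mulrC ler_pdivrMr// mul1r.
by rewrite scalerA divff ?gt_eqF// scale1r addrC subrK.
Qed.

(** Coverings indexed by tuples of choices are natural in the counting argument;
    surplus indices in 'I_N are sent to the default centre 0. *)
Lemma covered_by_finType (R : realType) (n : nat) (q : 'rV[R]_n -> R)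
    (K : set 'rV[R]_n) (N : nat) (eps : R) (T : finType) (c : T -> 'rV[R]_n) :
  quasinorm q -> 0 < eps -> (#|T| <= N)%N ->
  (forall x, K x -> exists i, q (x - c i) <= eps) ->
  Defs.covered_by q K N eps.
Proof.
move=> hq e0 TN Kc; exists (fun j : 'I_N => nth 0 (map c (enum T)) j) => x Kx.
have [i qi] := Kc x Kx.
have iN : (enum_rank i < N)%N by exact: leq_trans (ltn_ord _) TN.
exists (Ordinal iN) => //.
rewrite scaled_unit_ballP//= (nth_map i); last by rewrite -cardE.
by rewrite nth_enum_rank.
Qed.

Lemma entropy_number_ge0 (R : realType) (n : nat) (q : 'rV[R]_n -> R) K k :
  (0 <= entropy_number q K k)%E.
Proof. by apply: le_ereal_inf_tmp => _ [eps [e0 _] <-]; rewrite lee_fin ltW. Qed.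

(** The strict inequality replaces attainment of the infimum: some admissible
    radius lies below eps, and a covering may be enlarged to radius eps. *)
Lemma entropy_number_lt (R : realType) (n : nat) (q : 'rV[R]_n -> R) K k
    (eps : R) : quasinorm q -> (entropy_number q K k < eps%:E)%E ->
  exists c : 'I_(2 ^ k.-1) -> 'rV[R]_n,
    forall x, K x -> exists j, q (x - c j) <= eps.
Proof.
move=> hq /ereal_inf_lt[_ [r [r0 [c Kc]] <-]]; rewrite lte_fin => r_eps.
exists c => x /Kc[j _]; rewrite scaled_unit_ballP// => qj.
by exists j; rewrite (le_trans qj)// ltW.
Qed.

(** * Spheres of monotone quasi-norms *)

Lemma sign_vectorM (R : realType) (n : nat) (e : 'rV[R]_n) j :
  sign_vector e -> e 0 j * e 0 j = 1.
Proof. by move=> /(_ j)[] ->; rewrite ?mulrNN mulr1. Qed.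

Lemma orthant_abs (R : realType) (n : nat) (e x : 'rV[R]_n) j :
  sign_vector e -> orthant e x -> `|x 0 j| = e 0 j * x 0 j.
Proof.
move=> he hx; rewrite -[RHS]ger0_norm ?hx// normrM.
by case: (he j) => ->; rewrite ?normrN normr1 mul1r.
Qed.

(** If eta were positive, x would dominate a *: y with a > 1 close to 1, and
    monotonicity would give 1 = q x >= a * q y = a. *)
Lemma unit_sphere_no_gap (R : realType) (n : nat) (q : 'rV[R]_n -> R)
    (e x y : 'rV[R]_n) (eta : R) :
  quasinorm q -> monotone_qnorm q -> sign_vector e ->
  orthant e x -> orthant e y -> unit_sphere q x -> unit_sphere q y ->
  (forall j, `|y 0 j| + eta <= `|x 0 j|) -> eta <= 0.
Proof.
move=> hq mq he ox oy qx qy gap; rewrite leNgt; apply/negP => eta0.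
(* a |y_j| <= |y_j| + eta as |y_j| <= M; the 1 in M only avoids dividing by 0. *)
pose M := `|y| + 1; have M0 : 0 < M by rewrite ltr_wpDl.
pose a := 1 + eta / M.
have a1 : 1 < a by rewrite ltrDl divr_gt0.
have a0 : 0 <= a by lra.
have : q (a *: y) <= q x.
  apply: (mq e) => // j; rewrite mxE; first by rewrite mulrCA mulr_ge0.
  rewrite normrM ger0_norm//; apply: le_trans (gap j).
  rewrite mulrDl mul1r lerD2l mulrAC ler_pdivrMr// ler_pM2l//.
  have : `|y 0 j| <= `|y| := (normr_row_leP y (normr_ge0 y)).2 (lexx _) j.
  by rewrite /M; lra.
by rewrite quasinormZ// qx qy mulr1 ger0_norm// leNgt a1.
Qed.

(** The centre is c + (t0 + eps) *: e, where t0 is the infimum of the parameters t of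
    points of the sphere in the tube.  A centre chosen at an arbitrary such
    point would only give radius 4 eps: two points of the tube can differ by
    2 eps transversally and by another 2 eps along e. *)
Lemma tube_in_cube (R : realType) (n : nat) (q : 'rV[R]_n -> R)
    (e c : 'rV[R]_n) (eps : R) :
  quasinorm q -> monotone_qnorm q -> sign_vector e ->
  exists z, forall x t, unit_sphere q x -> orthant e x ->
    `|x - t *: e - c| <= eps -> `|x - z| <= 2 * eps.
Proof.
move=> hq mq he.
pose T := [set t | exists x,
  [/\ unit_sphere q x, orthant e x & `|x - t *: e - c| <= eps]].
have [T0|T0] := pselect (T !=set0); last first.
  (* no point of the sphere to cover: the centre is arbitrary *)
  by exists 0 => x t qx ox xt; exfalso; apply: T0; exists t, x.
have Tdiam s t : T s -> T t -> t - s <= 2 * eps.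
  move=> [y [qy oy ys]] [x [qx ox xt]].
  rewrite -subr_le0; apply: (unit_sphere_no_gap hq mq he ox oy qx qy) => j.
  rewrite !(orthant_abs _ he)//.
  have eps0 : 0 <= eps by exact: le_trans xt.
  have := (normr_row_leP _ eps0).2 xt j; have := (normr_row_leP _ eps0).2 ys j.
  by rewrite !mxE !ler_norml; case: (he j) => ->; lra.
have infT t : T t -> inf T <= t <= inf T + 2 * eps.
  move=> Tt; apply/andP; split.
    apply: ge_inf => //; have [s Ts] := T0; exists (s - 2 * eps) => r Tr.
    by have := Tdiam r s Tr Ts; lra.
  rewrite -lerBlDr; apply: lb_le_inf => // s Ts.
  by have := Tdiam s t Ts Tt; lra.
exists (c + (inf T + eps) *: e) => x t qx ox xt.
have /infT/andP[t1 t2] : T t by exists x.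
have eps0 : 0 <= eps by exact: le_trans xt.
apply/normr_row_leP => [|j]; first by rewrite mulr_ge0.
have := (normr_row_leP _ eps0).2 xt j.
by rewrite !mxE !ler_norml; case: (he j) => ->; lra.
Qed.

Definition sign_row (R : realType) (n : nat) (s : {ffun 'I_n -> bool}) : 'rV[R]_n :=
  \row_j (-1) ^+ s j.

Lemma sign_rowP (R : realType) (n : nat) s : sign_vector (@sign_row R n s).
Proof. by move=> j; rewrite mxE; case: (s j); [left|right]. Qed.

(** The section of [col' i] with image [hyperplane i]. *)
Definition insert0 (R : realType) (n : nat) (i : 'I_n) (c : 'rV[R]_n.-1) :
    'rV[R]_n :=
  \row_j (if unlift i j is Some j' then c 0 j' else 0).

Lemma norm_insert0 (R : realType) (n : nat) (i : 'I_n) (x : 'rV[R]_n) c eps :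
  hyperplane i x -> `|col' i x - c| <= eps -> `|x - insert0 i c| <= eps.
Proof.
move=> xi xc; have eps0 : 0 <= eps by exact: le_trans xc.
apply/normr_row_leP => // j; rewrite !mxE.
case: unliftP => [j' ->|->]; last by rewrite xi subrr normr0.
by have := (normr_row_leP _ eps0).2 xc j'; rewrite !mxE.
Qed.

(** Subtracting the smallest absolute value from all absolute values moves x,
    inside its orthant, along the diagonal to the boundary of the orthant; the
    absolute values decrease, so monotonicity keeps the point in the ball. *)
Lemma sphere_to_section (R : realType) (n : nat) (q : 'rV[R]_n -> R)
    (x : 'rV[R]_n) :
  (0 < n)%N -> monotone_qnorm q -> unit_sphere q x ->
  exists s i t, orthant (sign_row R s) x /\
    (unit_ball q `&` hyperplane i) (x - t *: sign_row R s).
Proof.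
move=> n0 mq qx; pose s := [ffun j => x 0 j < 0]; pose e := sign_row R s.
have ex j : x 0 j = e 0 j * `|x 0 j| by rewrite !mxE ffunE -numEsign.
have ee j : e 0 j * e 0 j = 1 by apply: sign_vectorM; exact: sign_rowP.
have ox : orthant e x by move=> j; rewrite ex mulrA ee mul1r.
pose i := [arg min_(j < Ordinal n0) `|x 0 j|]%O.
have xi j : `|x 0 i| <= `|x 0 j| by rewrite /i; case: arg_minP => // k _; exact.
exists s, i, `|x 0 i|; split=> //.
have x'E j : (x - `|x 0 i| *: e) 0 j = e 0 j * (`|x 0 j| - `|x 0 i|).
  by rewrite mulrBr -ex !mxE (mulrC `|_|).
split; last by rewrite /hyperplane/= x'E subrr mulr0.
rewrite /unit_ball/= -qx; apply: (mq e) => // [|j|j].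
- exact: sign_rowP.
- by rewrite x'E mulrA ee mul1r subr_ge0.
- rewrite x'E normrM; have -> : `|e 0 j| = 1 by rewrite !mxE normr_sign.
  by rewrite mul1r ger0_norm ?subr_ge0// gerBl.
Qed.

(** * Covering the sphere by cubes *)

Lemma covered_unit_sphere (R : realType) (n N M : nat) (p q : 'rV[R]_n -> R)
    (l eps : R) (c : 'I_n -> 'I_N -> 'rV[R]_n.-1) :
  (0 < n)%N -> quasinorm p -> monotone_qnorm p -> quasinorm q ->
  (2 ^ n * n * N <= M)%N -> 0 < l -> (forall x, q x <= l * `|x|) -> 0 < eps ->
  (forall i x, section_ball p i x -> exists j, `|x - c i j| <= eps) ->
  Defs.covered_by q (unit_sphere p) M (2 * l * eps).
Proof.
move=> n0 hp mp hq NM l0 ql eps0 pc.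
have /choice[z hz] : forall a : {ffun 'I_n -> bool} * 'I_n * 'I_N, exists z,
    forall x t, unit_sphere p x -> orthant (sign_row R a.1.1) x ->
    `|x - t *: sign_row R a.1.1 - insert0 a.1.2 (c a.1.2 a.2)| <= eps ->
    `|x - z| <= 2 * eps.
  by move=> a; apply: tube_in_cube => //; exact: sign_rowP.
apply: (@covered_by_finType _ _ _ _ _ _ _ z) => //.
- by rewrite !mulr_gt0.
- by rewrite !card_prod card_ffun card_bool !card_ord.
- move=> x px; have [s [i [t [ox xt]]]] := sphere_to_section n0 mp px.
  have [j xj] : exists j, `|col' i (x - t *: sign_row R s) - c i j| <= eps.
    by apply: pc; exists (x - t *: sign_row R s).
  exists (s, i, j); apply: (le_trans (ql _)).
  rewrite (mulrC 2) -mulrA ler_pM2l//; apply: (hz (s, i, j) x t) => //=.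
  by apply: norm_insert0 => //; case: xt.
Qed.

Theorem theorem12 (R : realType) (d : nat) (hd : (2 <= d)%N)
    (normX normY : 'rV[R]_d -> R)
    (hX : quasinorm normX) (hY : quasinorm normY)
    (monoX : monotone_qnorm normX)
    (k : nat) (hk : (d + up_log 2 d + 1 <= k)%N) :
  (entropy_number normY (unit_sphere normX) k <=
   2%:E * Id_norm normY *
   \big[maxe/-oo]_(i < d)
     entropy_number (@linfty R d.-1) (section_ball normX i)
       (k - d - up_log 2 d)%N)%E.
Proof.
have d0 : (0 < d)%N by exact: ltn_trans hd.
have [l [l0 -> Yl]] := Id_norm_fin d0 hY.
set m := (k - d - up_log 2 d)%N.
set E := (\big[maxe/-oo]_(i < d) _)%E.
have leE i : (entropy_number (@linfty R d.-1) (section_ball normX i) m <= E)%E.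
  exact: le_bigmax.
have E0 : (0 <= E)%E := le_trans (entropy_number_ge0 _ _ _) (leE (Ordinal d0)).
have card_le : (2 ^ d * d * 2 ^ m.-1 <= 2 ^ k.-1)%N.
  have -> : k.-1 = (d + up_log 2 d + m.-1)%N by rewrite /m; lia.
  by rewrite !expnD leq_mul2r leq_mul2l up_logP// !orbT.
have entropy_le eps : (E < eps%:E)%E ->
    (entropy_number normY (unit_sphere normX) k <= (2 * l * eps)%:E)%E.
  move=> Eeps; have eps0 : 0 < eps by rewrite -lte_fin; exact: le_lt_trans Eeps.
  have /choice[c hc] i := entropy_number_lt (@linfty_quasinorm R d.-1)
    (le_lt_trans (leE i) Eeps).
  apply: ereal_inf_lbound; exists (2 * l * eps) => //; split.
    by rewrite !mulr_gt0.
  exact: covered_unit_sphere card_le l0 Yl eps0 hc.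
case: E E0 entropy_le {leE} => [r||] //.
- move=> _ H; rewrite -!EFinM; apply/lee_addgt0Pr => a a0.
  have l2 : 0 < 2 * l by rewrite mulr_gt0.
  have := H (r + a / (2 * l)); rewrite lte_fin ltrDl divr_gt0// => /(_ isT).
  by rewrite mulrDr (mulrC _ (a / _)) divfK ?gt_eqF// EFinD.
- by rewrite -EFinM gt0_muley ?leey// lte_fin mulr_gt0.
Qed.
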